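(* Let $F$ be a field with a non-trivial involution $c$, let $n \geq 2$, and let $g \in \mathrm{GL}_n(F)$. Then $g$ is $c$-real if and only if $g$ has a unitary representation of dimension $n$, i.e. there exists a non-degenerate $c$-hermitian form $\sigma$ on $V=F^n$ that is $g$-invariant: $\sigma(gv, gw) = \sigma(v,w)$ for all $v, w \in V$.
   Context: An involution on a field $F$ is an automorphism $c:\alpha\mapsto\alpha^c$ of $F$ with $(\alpha^c)^c=\alpha$ for all $\alpha\in F$; it is non-trivial if it is not the identity. For a matrix $g=(a_{ij})\in \mathrm{GL}_n(F)$ put $g^c=(a_{ij}^c)$. The element $g$ is called $c$-real if $g$ is conjugate in $\mathrm{GL}_n(F)$ to $(g^c)^{-1}$. A $c$-sesquilinear form on an $F$-vector space $V$ is a bi-additive map $\sigma:V\times V\to F$ with $\sigma(\alpha v,\beta w)=\alpha\beta^c\sigma(v,w)$ for all $\alpha,\beta\in F$, $v,w\in V$; it is $c$-hermitian if moreover $\sigma(v,w)=\sigma(w,v)^c$ for all $v,w\in V$. A unitary group of degree $n$ over $F$ is the group of linear isometries of a non-degenerate $c$-hermitian form on an $n$-dimensional $F$-vector space. *)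

(* Defs.v *)
From mathcomp Require Import all_boot all_order all_algebra.
Set Implicit Arguments.
Unset Strict Implicit.
Unset Printing Implicit Defensive.
Import GRing.Theory.
Local Open Scope ring_scope.

Definition nontrivial (F : fieldType) (c : involutive_rmorphism F) : Prop :=
  ~ (c =1 id).

Definition c_real (F : fieldType) (c : involutive_rmorphism F) (n : nat)
    (g : 'M[F]_n) : Prop :=
  g ~_{in unitmx} invmx (map_mx c g).

Lemma c_realP (F : fieldType) (c : involutive_rmorphism F) (n : nat)
    (g : 'M[F]_n) :
  c_real c g <->
  exists2 p, p \in unitmx & p *m g *m invmx p = invmx (map_mx c g).
Proof.
by split=> -[p pU] => [/(simmxRL pU)|] h; exists p => //; apply/(simmxRL pU).
Qed.

(* An element of {hermitian_sym V for c} is linear in its first argument,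
   c-semilinear in its second, and satisfies s v w = c (s w v). *)
Definition has_unitary_rep (F : fieldType) (c : involutive_rmorphism F)
    (n : nat) (g : 'M[F]_n) : Prop :=
  exists sigma : {hermitian_sym 'cV[F]_n for c},
    nondegenerate sigma /\ isometry sigma sigma (mulmx g).

(* Main.v *)
(** Write a sesquilinear form as [u^T B v^c]; it is [g]-invariant iff
    [g^T B g^c = B].  If [B] is invertible this says that [g^T] is conjugate to
    [(g^c)^-1], and a matrix over a field is conjugate to its transpose, so [g]
    is [c]-real iff it preserves some nondegenerate sesquilinear form [B].  It
    remains to make [B] hermitian.  Let [A'] be the conjugate transpose of [A]
    and put [Z = B^-1 B'], which is an isometry of [B] commuting with [g^c].  If
    [p(X) = X^(2k+1) p^c(1/X)], then [Z'^k B p(Z)] is hermitian and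
    [g]-invariant, and it is nondegenerate as soon as [p] is coprime to the
    characteristic polynomial of [Z].  Such a [p] exists over every field, finite ones included: the irreducible factors are
    treated one at a time, since an irreducible polynomial other than [X] cannot
    divide all the polynomials [a + a^c X] when [c] is nontrivial. *)

Require Import Defs.
From HB Require Import structures.
From mathcomp Require Import all_boot all_order all_algebra.
From mathcomp Require Import perm zify ring.
From Stdlib Require Import Classical.
Set Implicit Arguments.
Unset Strict Implicit.
Unset Printing Implicit Defensive.
Import GRing.Theory.
Local Open Scope ring_scope.

(** * Equivalence of a polynomial matrix with its transpose *)

Section TransposeEquivalence.
Variable F : fieldType.

Definition trmx_equiv n (M : 'M[{poly F}]_n) : Prop :=
  exists L R, [/\ L \in unitmx, R \in unitmx & M^T = L *m M *m R].

Lemma trmx_equiv_mul n (U M V : 'M[{poly F}]_n) :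
  U \in unitmx -> V \in unitmx -> trmx_equiv (U *m M *m V) -> trmx_equiv M.
Proof.
move=> uU uV [L [R [uL uR defM]]].
exists (invmx V^T *m L *m U), (V *m R *m invmx U^T).
rewrite !unitmx_mul !unitmx_inv !unitmx_tr uU uV uL uR; split=> //.
have uUT : U^T \in unitmx by rewrite unitmx_tr.
have uVT : V^T \in unitmx by rewrite unitmx_tr.
transitivity (invmx V^T *m (U *m M *m V)^T *m invmx U^T).
  by rewrite !trmx_mul !mulmxA mulVmx // mul1mx mulmxK.
by rewrite defM !mulmxA.
Qed.

Lemma trmx_equiv_tr n (M : 'M[{poly F}]_n) : trmx_equiv M^T -> trmx_equiv M.
Proof.
move=> [L [R [uL uR]]]; rewrite trmxK => defM.
exists (invmx L), (invmx R); rewrite !unitmx_inv; split=> //.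
by rewrite {2}defM !mulmxA mulVmx // mul1mx mulmxK.
Qed.

(** Row division by the pivot [M 0 0]: [U] subtracts from each lower row a multiple of the first
    one. Below a nonzero pivot only remainders of smaller size stay. *)
Lemma clear_column n (M : 'M[{poly F}]_(1 + n)) :
  exists2 U, U \in unitmx & exists D, U *m M =
    block_mx (ulsubmx M) (ursubmx M)
             (map_mx (fun p => p %% M 0 0) (dlsubmx M)) D.
Proof.
pose Q := map_mx (fun p => p %/ M 0 0) (dlsubmx M).
exists (block_mx 1%:M 0 (- Q) 1%:M).
  by rewrite unitmxE det_lblock !det1 mulr1 unitr1.
exists (- Q *m ursubmx M + drsubmx M).
rewrite -{1}(submxK M) mulmx_block !mul1mx !mul0mx !addr0; congr block_mx.
apply/matrixP=> i j; rewrite [ulsubmx M]mx11_scalar mul_mx_scalar !mxE.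
rewrite {j}ord1 !lshift0 {2}(divp_eq (M (rshift 1 i) 0) (M 0 0)).
by rewrite mulrN mulrC addKr.
Qed.

Lemma trmx_equiv_block n a (D : 'M[{poly F}]_n) :
  trmx_equiv D -> trmx_equiv (block_mx (a%:M : 'M_1) 0 0 D).
Proof.
move=> [L [R [uL uR defD]]].
exists (block_mx 1%:M 0 0 L), (block_mx 1%:M 0 0 R).
rewrite !unitmxE !det_ublock !det1 !mul1r -!unitmxE; split=> //.
rewrite tr_block_mx !mulmx_block !(mul0mx, mulmx0, addr0, add0r, trmx0).
by rewrite mul1mx mulmx1 tr_scalar_mx defD.
Qed.

(* Transposition preserves block diagonal matrices, and a pivot of minimal degree
   clears its row and column, which leaves a smaller block. *)
Lemma trmx_equivP n (M : 'M[{poly F}]_n) : trmx_equiv M.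
Proof.
elim: n => [|n IHn] in M *.
  by exists 1%:M, 1%:M; rewrite !unitmx1 (flatmx0 M^T) (flatmx0 (_ *m _)).
(* Induction on a bound [k] for the size of the pivot: a nonzero remainder, swapped to the top, is a
   smaller pivot. *)
have pivot k : forall N : 'M[{poly F}]_(1 + n),
    N 0 0 != 0 -> (size (N 0 0)%R <= k)%N -> trmx_equiv N.
  elim: k => [|k IHk] N nzN szN.
    by move: szN; rewrite leqNgt size_poly_gt0 nzN.
  have swap (N' : 'M[{poly F}]_(1 + n)) i : N' (rshift 1 i) 0 != 0 ->
      (size (N' (rshift 1 i) 0)%R < size (N 0 0)%R)%N -> trmx_equiv N'.
    move=> nz lt; apply: (@trmx_equiv_mul _ (tperm_mx (rshift 1 i) 0) _ 1%:M).
    - exact: unitmx_perm.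
    - exact: unitmx1.
    rewrite mulmx1 -xrowE; apply: IHk; rewrite mxE tpermR //.
    by rewrite -ltnS (leq_trans lt).
  have [U uU [D defUN]] := clear_column N.
  apply: (@trmx_equiv_mul _ U _ 1%:M); rewrite ?unitmx1 // mulmx1.
  have [i nzi|all0] := pickP (fun i : 'I_n => (U *m N) (rshift 1 i) 0 != 0).
    apply: (swap _ i) => //.
    by rewrite defUN -(lshift0 n 0) block_mxEdl mxE lshift0 ltn_modp.
  have dl0 : map_mx (fun p => p %% N 0 0) (dlsubmx N) = 0.
    apply/matrixP=> i j; have /negbFE/eqP := all0 i.
    by rewrite defUN -(lshift0 n 0) block_mxEdl (ord1 j) => ->; rewrite mxE.
  rewrite {}dl0 in defUN; rewrite {all0}defUN.
  (* The column is clear. After transposition the same division clears the row, and the zero block,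
     now at the upper right, is preserved by it. *)
  apply: trmx_equiv_tr; rewrite tr_block_mx trmx0.
  set N2 := block_mx _ _ _ _; have [V uV [E defVN]] := clear_column N2.
  have N200 : N2 0 0 = N 0 0.
    by rewrite /N2 -{1 2}(lshift0 n 0) block_mxEul !mxE !lshift0.
  apply: (@trmx_equiv_mul _ V _ 1%:M); rewrite ?unitmx1 // mulmx1.
  have [i nzi|all0] := pickP (fun i : 'I_n => (V *m N2) (rshift 1 i) 0 != 0).
    apply: (swap _ i) => //.
    by rewrite defVN -(lshift0 n 0) block_mxEdl mxE lshift0 N200 ltn_modp.
  have dl0 : map_mx (fun p => p %% N2 0 0) (dlsubmx N2) = 0.
    apply/matrixP=> i j; have /negbFE/eqP := all0 i.
    by rewrite defVN -(lshift0 n 0) block_mxEdl (ord1 j) => ->; rewrite mxE.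
  have ur0 : ursubmx N2 = 0 by apply: block_mxKur.
  rewrite defVN dl0 ur0 (mx11_scalar (ulsubmx N2)); exact: trmx_equiv_block.
have [[i j] /= nzM|M0] := pickP (fun k => M k.1 k.2 != 0); last first.
  have -> : M = 0.
    by apply/matrixP=> i j; have /negbFE/eqP-> := M0 (i, j); rewrite mxE.
  by exists 1%:M, 1%:M; rewrite !unitmx1 trmx0 mulmx0 mul0mx.
apply: (@trmx_equiv_mul _ (tperm_mx i 0) _ (tperm_mx j 0)).
- exact: unitmx_perm.
- exact: unitmx_perm.
by rewrite -xrowE -xcolE; apply: pivot; rewrite ?leqnn // !mxE !tpermR.
Qed.

End TransposeEquivalence.

(** * Evaluation over noncommutative rings, and similarity of matrices *)

(** Coefficients stand to the left of the powers of [x], so evaluation is not multiplicative; but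
    [x] commutes with its own powers, which lets [q.[x]] be formed right after the coefficients of
    [p]. *)
Lemma hornerM_eval (R : nzRingType) (p q : {poly R}) (x : R) :
  (p * q).[x] = (p * (q.[x])%:P).[x].
Proof.
elim/poly_ind: p => [|p c IHp]; first by rewrite !mul0r.
rewrite !mulrDl -!mulrA -!commr_polyX !mulrA !hornerD !hornerMX IHp.
by rewrite !hornerCM hornerC.
Qed.

Lemma horner_intertwine (R : nzRingType) (p : {poly R}) (x y z : R) :
  x * y = z * x -> (p * x%:P).[y] = p.[z] * x.
Proof.
move=> xy; elim/poly_ind: p => [|p c IHp]; first by rewrite mul0r !horner0 mul0r.
rewrite mulrDl -mulrA -commr_polyX mulrA -polyCM !hornerD !hornerMX IHp.
by rewrite !hornerC mulrDl -!mulrA xy.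
Qed.

(* Evaluating [U (X - B) = (X - A) V] on the right at [B] yields [V(B) B = A V(B)],
   and [V(B)] is inverted by the evaluation of [V^-1] at [A]. *)
Lemma simmx_of_equiv (F : fieldType) n (A B : 'M[F]_n.+1)
    (U V : 'M[{poly F}]_n.+1) :
  U \in unitmx -> V \in unitmx ->
  U *m char_poly_mx B = char_poly_mx A *m V -> A ~_{in unitmx} B.
Proof.
move=> uU uV eqUV.
have [phi [_ phiC phiM _]] := mx_poly_ring_isom F n.
have phi_char C : phi (char_poly_mx C) = 'X - C%:P.
  by rewrite rmorphB /= phiC phiM map_polyX.
have eval (P Q : 'M[{poly F}]_n.+1) (C D : 'M[F]_n.+1) :
    P *m char_poly_mx C = char_poly_mx D *m Q ->
  (phi Q).[C] * C = D * (phi Q).[C].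
  move=> /(congr1 phi); rewrite !rmorphM !phi_char => eqPQ.
  (* This product equals [phi P * ('X - C%:P)], whose right factor makes it vanish at [C]. *)
  have : (('X - D%:P) * phi Q).[C] = 0.
    by apply/rootP/factor_theorem; exists (phi P).
  by rewrite mulrBl -commr_polyX hornerD hornerMX hornerN hornerCM => /subr0_eq.
have eqV := eval _ _ _ _ eqUV.
have eqV' : (phi (invmx V)).[A] * A = B * (phi (invmx V)).[A].
  apply: (eval (invmx U)).
  by apply: (canRL (mulmxK uV)); rewrite -mulmxA -eqUV mulmxA mulVmx ?mul1mx.
have VV1 : (phi (invmx V)).[A] * (phi V).[B] = 1.
  rewrite -(horner_intertwine _ eqV) -hornerM_eval -rmorphM.
  by rewrite [_ * _](mulVmx uV) rmorph1 hornerC.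
have uVA : (phi (invmx V)).[A] \in unitmx.
  by case/mulmx1_unit: VV1.
by exists (phi (invmx V)).[A] => //; apply/(simmxP uVA).
Qed.

Lemma simmx_trmx (F : fieldType) n (A : 'M[F]_n.+1) : A ~_{in unitmx} A^T.
Proof.
have [L [R [uL uR defT]]] := trmx_equivP (char_poly_mx A).
apply: (@simmx_of_equiv _ _ _ _ (invmx L) R); rewrite ?unitmx_inv //.
have -> : char_poly_mx A^T = (char_poly_mx A)^T.
  by rewrite /char_poly_mx linearB /= tr_scalar_mx map_trmx.
by rewrite defT !mulmxA mulVmx // mul1mx.
Qed.

(** * Palindromic polynomials coprime to a given polynomial *)

Lemma irreducible_divisor_ex (F : fieldType) (m : {poly F}) :
  (1 < size m)%N -> exists2 q, irreducible_poly q & q %| m.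
Proof.
have [k] := ubnP (size m); elim: k m => // k IHk m szm m_gt1.
(* Over a general field irreducibility comes with no boolean test, hence the excluded middle. *)
have [irr_m|red_m] := classic (irreducible_poly m); first by exists m.
have [q [szq qm neq]] : exists q : {poly F}, [/\ size q != 1, q %| m & ~~ (q %= m)].
  apply: NNPP => none; apply: red_m; split=> // q szq qm.
  by apply: contraT => neq; case: none; exists q.
have m_nz : m != 0 by rewrite -size_poly_gt0 ltnW.
have q_nz : q != 0 by apply: contraTneq qm => ->; rewrite dvd0p.
have ltqm : (size q < size m)%N.
  by rewrite ltn_neqAle dvdp_leq // andbT dvdp_size_eqp.
have q_gt1 : (1 < size q)%N by rewrite ltn_neqAle eq_sym szq size_poly_gt0.
have [|r irr_r rq] := IHk q _ q_gt1; first exact: leq_trans ltqm _.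
by exists r => //; apply: dvdp_trans rq qm.
Qed.

Section ConjugateReversal.
Variables (F : fieldType) (c : involutive_rmorphism F).
Implicit Types p q m : {poly F}.

(* [conj_rev d p] is [X^d p^c(1/X)], for [p] of degree at most [d]. *)
Definition conj_rev d p := \poly_(i < d.+1) c p`_(d - i).

Lemma conj_revE d p i :
  (conj_rev d p)`_i = if (i <= d)%N then c p`_(d - i) else 0.
Proof. by rewrite coef_poly ltnS. Qed.

Lemma size_conj_rev d p : (size (conj_rev d p) <= d.+1)%N.
Proof. exact: size_poly. Qed.

Lemma conj_rev0 d : conj_rev d 0 = 0.
Proof. by apply/polyP=> i; rewrite conj_revE !coef0 rmorph0 if_same. Qed.

Lemma conj_revD d p q : conj_rev d (p + q) = conj_rev d p + conj_rev d q.
Proof.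
apply/polyP=> i; rewrite coefD !conj_revE coefD rmorphD.
by case: ifP; rewrite ?addr0.
Qed.

Lemma conj_rev_monomial d a i :
  (i <= d)%N -> conj_rev d (a *: 'X^i) = c a *: 'X^(d - i).
Proof.
move=> le_id; apply/polyP=> j; rewrite conj_revE !coefZ !coefXn.
case: ifP => [le_jd|]; last first.
  move=> /negbT; rewrite -ltnNge => lt_dj.
  by rewrite gtn_eqF ?mulr0 // (leq_ltn_trans (leq_subr _ _)).
rewrite rmorphM rmorph_nat; congr (_ * _%:R); congr (nat_of_bool _).
by apply/eqP/eqP=> [<-|->]; rewrite subKn.
Qed.

Lemma conj_rev_sum d (I : Type) (r : seq I) (P : pred I) (f : I -> {poly F}) :
  conj_rev d (\sum_(i <- r | P i) f i) = \sum_(i <- r | P i) conj_rev d (f i).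
Proof. exact: (big_morph _ (conj_revD d) (conj_rev0 d)). Qed.

Lemma poly_monomials d p :
  (size p <= d.+1)%N -> p = \sum_(i < d.+1) p`_i *: 'X^i.
Proof.
move=> le_pd; rewrite -poly_def; apply/polyP=> i; rewrite coef_poly.
by case: ltnP => // le_di; rewrite nth_default // (leq_trans le_pd).
Qed.

(** Both sides are biadditive, which reduces the claim to monomials. The size bounds matter because
    [conj_rev d] drops coefficients beyond [d]. *)
Lemma conj_revM d e p q : (size p <= d.+1)%N -> (size q <= e.+1)%N ->
  conj_rev (d + e) (p * q) = conj_rev d p * conj_rev e q.
Proof.
move=> /poly_monomials-> /poly_monomials->.
rewrite big_distrlr !conj_rev_sum big_distrlr; apply: eq_bigr => i _ /=.
rewrite conj_rev_sum; apply: eq_bigr => j _.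
have [le_id le_je] : (i <= d)%N /\ (j <= e)%N by split; rewrite -ltnS.
rewrite -scalerAl -scalerAr scalerA -exprD !conj_rev_monomial ?leq_add //.
rewrite -scalerAl -scalerAr scalerA -exprD rmorphM.
by congr (_ *: 'X^_); lia.
Qed.

Lemma conj_revK d p : (size p <= d.+1)%N -> conj_rev d (conj_rev d p) = p.
Proof.
move=> le_pd; apply/polyP=> i; rewrite !conj_revE leq_subr.
case: leqP => [le_id|lt_di]; first by rewrite rmorphK subKn.
by rewrite nth_default // (leq_trans le_pd).
Qed.

(** Here [d] is a formal degree, possibly larger than that of [p]: ['X^d] is palindromic for
    [d + d]. *)
Definition palindromic d p : Prop := conj_rev d p = p.

Lemma palindromic_size d p : palindromic d p -> (size p <= d.+1)%N.
Proof. by move=> <-; apply: size_conj_rev. Qed.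

Lemma palindromicD d p q :
  palindromic d p -> palindromic d q -> palindromic d (p + q).
Proof. by rewrite /palindromic conj_revD => -> ->. Qed.

Lemma palindromicM d e p q :
  palindromic d p -> palindromic e q -> palindromic (d + e) (p * q).
Proof.
move=> pal_p pal_q; rewrite /palindromic conj_revM ?palindromic_size //.
by rewrite pal_p pal_q.
Qed.

Lemma palindromicXn d : palindromic (d + d) 'X^d.
Proof.
rewrite /palindromic -['X^d in LHS]scale1r conj_rev_monomial ?leq_addl //.
by rewrite rmorph1 scale1r addnK.
Qed.

Lemma palindromic_norm d p :
  (size p <= d.+1)%N -> palindromic (d + d) (p * conj_rev d p).
Proof.
move=> le_pd; rewrite /palindromic conj_revM ?size_conj_rev //.
by rewrite conj_revK // mulrC.
Qed.

Lemma palindromic_linear a : palindromic 1 (a%:P + c a *: 'X).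
Proof.
have := @conj_rev_monomial 1 (c a) 1 isT; rewrite rmorphK expr0 expr1 => revX.
have := @conj_rev_monomial 1 a 0 isT; rewrite expr0 expr1 !alg_polyC => rev1.
by rewrite /palindromic conj_revD rev1 revX alg_polyC addrC.
Qed.

(** Reversing a Bezout identity for [p] and [m] fixes [p] and turns [1] into a power of ['X]. *)
Lemma conj_rev_Bezout d e p m : palindromic d p -> (size m <= e.+1)%N ->
  coprimep p m -> exists N (u v : {poly F}), u * p + v * conj_rev e m = 'X^N.
Proof.
move=> pal_p le_me /Bezout_eq1_coprimepP[[u v] /= uv1].
(* A common bound for [u] and [v], so that both products can be reversed in the same formal degree
   [k + e + d]. *)
pose k := (size u + size v)%N.
exists (k + e + d)%N, (conj_rev (k + e) u), (conj_rev (k + d) v).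
rewrite -{1}pal_p -conj_revM ?(palindromic_size pal_p) //; last first.
  by rewrite /k; lia.
rewrite addnAC -conj_revM //; last first.
  by rewrite /k; lia.
rewrite -conj_revD uv1 -(expr0 'X) -['X^0]scale1r conj_rev_monomial //.
by rewrite rmorph1 scale1r subn0.
Qed.

(** Induction on the size of [m = m1 * q] with [q] irreducible. If [q] divides the [p] found for
    [m1], a multiple of [m1] coprime to [q] is added to a shift of [p]. *)
Lemma coprime_palindromic_ex m : ~ (c =1 id) -> ~~ root m 0 ->
  exists k p, palindromic k.*2.+1 p /\ coprimep p m.
Proof.
move=> nontriv_c.
have [l lP] : exists l, c l != l.
  apply: NNPP => none; apply: nontriv_c => l; apply/eqP; apply: contraT => l_nfix.
  by case: none; exists l.
have [n] := ubnP (size m); elim: n m => // n IHn m szm m0.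
have m_nz : m != 0 by apply: contraNneq m0 => ->; apply: root0.
have [m_gt1|m_le1] := ltnP 1 (size m); last first.
  exists 0, (1%:P + c 1 *: 'X); split; first exact: palindromic_linear.
  have /size_poly1P[a a_nz ->] : size m == 1%N.
    by rewrite eqn_leq m_le1 size_poly_gt0.
  by rewrite coprimep_sym -[a%:P]mulr1 mul_polyC coprimepZl // coprime1p.
have [q irr_q /dvdpP[m1 def_m]] := irreducible_divisor_ex m_gt1.
have [m1_nz q_nz] : m1 != 0 /\ q != 0.
  by apply/andP; rewrite -negb_or -mulf_eq0 -def_m.
have [m10 q0] : ~~ root m1 0 /\ ~~ root q 0.
  by apply/andP; rewrite -negb_or -rootM -def_m.
have [|k [p [pal_p co_pm1]]] := IHn m1 _ m10.
  have := irr_q.1; move: szm; rewrite def_m size_mul //.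
  rewrite -size_poly_gt0 in m1_nz; move: m1_nz.
  move: (size m1) (size q) => a b; lia.
have [co_qp|] := boolP (coprimep q p).
  by exists k, p; rewrite def_m coprimepMr co_pm1 coprimep_sym.
rewrite irreducible_poly_coprime // negbK => q_p.
have coX i (s : {poly F}) : ~~ root s 0 -> coprimep s 'X^i.
  move=> s0; have := coprimep_XsubC s 0; rewrite s0 polyC0 subr0 => co_sX.
  exact: coprimep_expr.
have [a co_qa] : exists a, coprimep q (a%:P + c a *: 'X).
  apply: NNPP => none; have div a : q %| a%:P + c a *: 'X.
    by apply: contraT => ndiv; case: none; exists a; rewrite irreducible_poly_coprime.
  (* Combining the cases [a = l] and [a = 1] cancels the constant term; then [q] would divide ['X],
     although [0] is not a root of [q]. *)
  have : q %| (c l - l) *: 'X.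
    have -> : (c l - l) *: 'X =
        (l%:P + c l *: 'X) - l *: (1%:P + c 1 *: 'X) :> {poly F}.
      rewrite (rmorph1 c) scale1r scalerDr alg_polyC opprD addrACA subrr add0r.
      by rewrite scalerBl.
    by apply: dvdp_sub => //; rewrite -mul_polyC dvdp_mull.
  rewrite dvdpZr ?subr_eq0 // => q_X.
  by have := coX 1%N q q0; rewrite irreducible_poly_coprime // expr1 q_X.
pose d := (size m1).-1; have le_m1 : (size m1 <= d.+1)%N by rewrite /d leqSpred.
pose r := m1 * conj_rev d m1.
(* Modulo [m1] only the first term survives, modulo [q] only the second. *)
exists (k + d)%N, ('X^d * p + 'X^k * r * (a%:P + c a *: 'X)); split.
  (* The factors ['X^d] and ['X^k] bring both summands to the same formal degree. *)
  have -> : (k + d).*2.+1 = (d + d + k.*2.+1)%N.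
    by rewrite doubleD addnS addnC addnn.
  apply: palindromicD; first exact: palindromicM (palindromicXn _) pal_p.
  have -> : (d + d + k.*2.+1)%N = (k + k + (d + d) + 1)%N.
    by rewrite addn1 addnS addnn addnC addnn.
  apply: palindromicM (palindromic_linear a).
  exact: palindromicM (palindromicXn _) (palindromic_norm le_m1).
have co_qm1 : coprimep q m1 by apply: coprimep_dvdr co_pm1.
(* Since [q] divides [p], if it also divided the reversal of [m1] it would divide a power of
   ['X]. *)
have co_qrev : coprimep q (conj_rev d m1).
  rewrite irreducible_poly_coprime //; apply/negP => q_rev.
  have [N [u [v defXN]]] := conj_rev_Bezout pal_p le_m1 co_pm1.
  have := coX N q q0; rewrite irreducible_poly_coprime // -defXN.
  by rewrite dvdp_add ?dvdp_mull.
rewrite coprimep_sym def_m coprimepMl; apply/andP; split.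
  have -> : 'X^d * p + 'X^k * r * (a%:P + c a *: 'X) =
      ('X^k * conj_rev d m1 * (a%:P + c a *: 'X)) * m1 + 'X^d * p.
    by rewrite /r; ring.
  by rewrite coprimep_addl_mul coprimepMr coX //= coprimep_sym.
have /dvdpP[p1 ->] := q_p.
have -> : 'X^d * (p1 * q) + 'X^k * r * (a%:P + c a *: 'X) =
    ('X^d * p1) * q + 'X^k * (m1 * conj_rev d m1) * (a%:P + c a *: 'X).
  by rewrite /r; ring.
by rewrite coprimep_addl_mul !coprimepMr coX // co_qm1 co_qrev.
Qed.

End ConjugateReversal.

(** * Conjugate transposes and invariant hermitian matrices *)

Section InvariantForms.
Variables (F : fieldType) (c : involutive_rmorphism F).

Definition adjmx m n (A : 'M[F]_(m, n)) : 'M_(n, m) := map_mx c A^T.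

Lemma adjmxK m n (A : 'M[F]_(m, n)) : adjmx (adjmx A) = A.
Proof. by apply/matrixP=> i j; rewrite !mxE rmorphK. Qed.

Lemma adjmx_mul m n p (A : 'M[F]_(m, n)) (B : 'M_(n, p)) :
  adjmx (A *m B) = adjmx B *m adjmx A.
Proof. by rewrite /adjmx trmx_mul map_mxM. Qed.

Lemma adjmxM n (A B : 'M[F]_n.+1) : adjmx (A * B) = adjmx B * adjmx A.
Proof. exact: adjmx_mul. Qed.

Lemma adjmx_unit n (A : 'M[F]_n) : (adjmx A \in unitmx) = (A \in unitmx).
Proof. by rewrite map_unitmx unitmx_tr. Qed.

Lemma adjmxX n (A : 'M[F]_n.+1) k : adjmx (A ^+ k) = adjmx A ^+ k.
Proof.
elim: k => [|k IHk]; first by rewrite !expr0 /adjmx trmx1 map_mx1.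
by rewrite exprS adjmxM IHk exprSr.
Qed.

Lemma invariant_hermitian_ex n (g B : 'M[F]_n.+1) :
  nontrivial c -> B \in unitmx -> g^T *m B *m map_mx c g = B ->
  exists H, [/\ H \in unitmx, adjmx H = H & g^T *m H *m map_mx c g = H].
Proof.
move=> nontriv_c uB invB; have uBr : B \is a GRing.unit by [].
have adj_cg : adjmx (map_mx c g) = g^T.
  by apply/matrixP=> i j; rewrite !mxE rmorphK.
have adj_gT : adjmx g^T = map_mx c g by rewrite /adjmx trmxK.
change (g^T * B * map_mx c g = B) in invB.
pose Z := B^-1 * adjmx B; set Y := adjmx Z.
have BZ : B * Z = adjmx B by rewrite /Z mulVKr.
have uZ : Z \in unitmx by rewrite unitmx_mul unitmx_inv uB adjmx_unit.
have isoZ : Y * B * Z = B.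
  by rewrite -mulrA BZ -adjmxM BZ adjmxK.
have invB' : g^T * adjmx B * map_mx c g = adjmx B.
  by rewrite -[in RHS]invB !adjmxM adj_cg adj_gT mulrA.
have ucg : map_mx c g \in unitmx.
  by move: uB; rewrite -{1}invB !unitmx_mul => /andP[_ ].
(* Both [B] and [B * Z] are [g]-invariant; cancelling [g^T * B] leaves the commutation. *)
have commZ : Z * map_mx c g = map_mx c g * Z.
  apply: (mulrI uBr); rewrite mulrA BZ.
  have ugT : g^T \is a GRing.unit.
    by rewrite [_ \in _]unitmx_tr -(map_unitmx c).
  apply: (mulrI ugT); rewrite mulrA invB' -BZ !mulrA.
  by rewrite invB.
have commY : g^T * Y = Y * g^T.
  by rewrite -adj_cg -adjmxM commZ adjmxM.
have Z0 : ~~ root (char_poly Z) 0.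
  by rewrite -eigenvalue_root_char; apply/eigenvalueP=> -[v] /eqP;
     rewrite scale0r => /eqP vZ0 /negP; apply; apply/eqP;
     rewrite -(mulmxK uZ v) vZ0 mul0mx.
have [k [p [pal_p co_p]]] := coprime_palindromic_ex nontriv_c Z0.
pose E i j := Y ^+ i * B * Z ^+ j.
have EDl a b m : E (a + m)%N (b + m)%N = E a b.
  elim: m => [|m IHm]; first by rewrite !addn0.
  by rewrite -IHm /E !addnS exprSr exprS -[in RHS]isoZ !mulrA.
(* The extra factor [Z] comes from [adjmx B = B * Z]; it is the reason for the odd formal degree of
   [p]. *)
have adjE i j : adjmx (E i j) = E j i.+1.
  by rewrite /E !adjmxM !adjmxX adjmxK -BZ exprS !mulrA.
pose H := Y ^+ k * B * horner_mx Z p.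
have defH : H = \sum_(i < k.*2.+2) p`_i *: E k i.
  rewrite /H {1}(poly_monomials (palindromic_size pal_p)) rmorph_sum mulr_sumr.
  apply: eq_bigr => i _ /=; rewrite horner_mxZ rmorphXn /= horner_mx_X.
  by rewrite -scalerAr.
exists H; split.
(* By Cayley-Hamilton, the Bezout identity evaluated at [Z] inverts [p] at [Z]. *)
- have [[u v] /= uv1] := Bezout_eq1_coprimepP _ _ co_p.
  have upZ : horner_mx Z u * horner_mx Z p = 1.
    by rewrite -(rmorph1 (horner_mx Z)) -uv1 rmorphD !rmorphM /=
       Cayley_Hamilton mulr0 addr0.
  have uY : Y \is a GRing.unit by rewrite [_ \in _]adjmx_unit.
  have [_ upz] := mulmx1_unit upZ.
  change (Y ^+ k *m B *m horner_mx Z p \in unitmx).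
  by rewrite !unitmx_mul upz uB (unitrX k uY).
- rewrite {1}defH /adjmx raddf_sum raddf_sum /= defH (reindex_inj rev_ord_inj).
  apply: eq_bigr => i _ /=; rewrite linearZ map_mxZ -/(adjmx _) adjE.
  have le_i : (i <= k.*2.+1)%N by rewrite -ltnS.
  rewrite subSS -{2}pal_p conj_revE le_i; congr (_ *: _).
  (* Both exponents differ by the same amount, the distance from [i] to [k.+1], which [EDl]
     absorbs. *)
  have [le_ki|lt_ik] := leqP k.+1 i.
    rewrite -(EDl _ _ (i - k.+1)%N); congr E; lia.
  rewrite -(EDl k _ (k.+1 - i)%N); congr E; lia.
have commYk : g^T * Y ^+ k = Y ^+ k * g^T by apply: commrX.
have commp : horner_mx Z p * map_mx c g = map_mx c g * horner_mx Z p.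
  exact: comm_horner_mx.
change (g^T * H * map_mx c g = H); rewrite /H !mulrA commYk.
by rewrite -!mulrA commp -[in RHS]invB !mulrA.
Qed.

(** * Hermitian forms and their Gram matrices *)

Lemma hermitian_form_ex n (H : 'M[F]_n) : adjmx H = H ->
  exists sigma : {hermitian_sym 'cV[F]_n for c},
    forall u v, sigma u v = (u^T *m H *m map_mx c v) 0 0.
Proof.
move=> adjH; pose f (u v : 'cV[F]_n) := (u^T *m H *m map_mx c v) 0 0.
have f_bilin : bilinear_for (GRing.Scale.Law.clone _ _ ( *%R ) _)
    (GRing.Scale.Law.clone _ _ (c \; *%R ) _) f.
  split=> [v|u] a x y; rewrite /f.
    by rewrite linearP !mulmxDl -!scalemxAl !mxE.
  by rewrite map_mxD map_mxZ mulmxDr -scalemxAr !mxE.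
(* The sign [(-1) ^+ false] selects hermitian rather than skew-hermitian symmetry. *)
have f_herm u v : f u v = (-1) ^+ false * c (f v u).
  rewrite expr0 mul1r /f.
  (* On 1 by 1 matrices [c] acts as [adjmx], which reverses the product defining [f]. *)
  have -> (A : 'M[F]_1) : c (A 0 0) = adjmx A 0 0 :> F by rewrite !mxE.
  rewrite !adjmx_mul adjH mulmxA.
  have -> : adjmx (map_mx c u) = u^T by apply/matrixP=> i j; rewrite !mxE rmorphK.
  by rewrite /adjmx trmxK.
pose m1 := bilinear_isBilinear.Build _ _ _ _ _ _ f f_bilin.
pose m2 := isHermitianSesquilinear.Build _ _ _ _ f f_herm.
by exists (HB.pack_for {hermitian_sym 'cV[F]_n for c} f m1 m2).
Qed.

Definition gram n (sigma : {hermitian_sym 'cV[F]_n for c}) : 'M[F]_n :=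
  \matrix_(i, j) sigma (delta_mx i 0) (delta_mx j 0).

Lemma gramE n (sigma : {hermitian_sym 'cV[F]_n for c}) u v :
  sigma u v = (u^T *m gram sigma *m map_mx c v) 0 0.
Proof.
have col_sum (w : 'cV[F]_n) : w = \sum_i w i 0 *: delta_mx i 0.
  by rewrite [LHS]matrix_sum_delta; apply: eq_bigr => i _; rewrite big_ord1.
rewrite {1}(col_sum v) linear_sumr mxE; apply: eq_bigr => j _ /=.
rewrite linearZr /= [in RHS]mxE mulrC; congr (_ * _); last by rewrite mxE.
rewrite {1}(col_sum u) linear_sumlz; apply: eq_bigr => i _ /=.
by rewrite linearZl !mxE.
Qed.

Lemma form_eqP m n (A B : 'M[F]_(m, n)) :
  (forall (u : 'cV[F]_m) (v : 'cV[F]_n),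
    (u^T *m A *m map_mx c v) 0 0 = (u^T *m B *m map_mx c v) 0 0) ->
  A = B.
Proof.
move=> eqAB; apply/matrixP=> i j.
have entry (M : 'M[F]_(m, n)) : ((delta_mx i 0 : 'cV_m)^T *m M *m
    map_mx c (delta_mx j 0 : 'cV_n)) 0 0 = M i j.
  by rewrite trmx_delta map_delta_mx -rowE -colE !mxE.
by rewrite -entry eqAB entry.
Qed.

(** Up to transposition, the orthogonal of the whole space is the left kernel of the Gram matrix. *)
Lemma nondegenerateP n (sigma : {hermitian_sym 'cV[F]_n for c}) :
  reflect (nondegenerate sigma) (gram sigma \in unitmx).
Proof.
apply: (iffP idP) => [uG|nondeg].
  rewrite /nondegenerate -subv0; apply/subvP=> u /mem_orthovP u_orth.
  have uG0 : u^T *m gram sigma = 0.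
    apply: form_eqP => w v; rewrite mulmx0 mul0mx [w^T]mx11_scalar.
    by rewrite mul_scalar_mx -scalemxAl [LHS]mxE -gramE u_orth ?memvf // mulr0 mxE.
  by rewrite memv0 -(trmxK u) -(mulmxK uG u^T) uG0 mul0mx trmx0.
rewrite -row_free_unit; apply: inj_row_free => w wG0.
have : w^T \in orthov sigma fullv.
  by apply/mem_orthovP=> v _; rewrite gramE trmxK wG0 mul0mx mxE.
by rewrite (eqP nondeg) memv0 => /eqP w0; rewrite -(trmxK w) w0 trmx0.
Qed.

Lemma isometryP n (sigma : {hermitian_sym 'cV[F]_n for c}) (g : 'M[F]_n) :
  isometry sigma sigma (mulmx g) <->
  g^T *m gram sigma *m map_mx c g = gram sigma.
Proof.
have sigma_g u v : sigma (g *m u) (g *m v) =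
    (u^T *m (g^T *m gram sigma *m map_mx c g) *m map_mx c v) 0 0.
  by rewrite gramE trmx_mul map_mxM !mulmxA.
split=> [iso_g|inv_g u v]; last by rewrite sigma_g inv_g -gramE.
by apply: form_eqP => u v; rewrite -sigma_g iso_g gramE.
Qed.

Lemma gram_form n (H : 'M[F]_n) (sigma : {hermitian_sym 'cV[F]_n for c}) :
  (forall u v, sigma u v = (u^T *m H *m map_mx c v) 0 0) -> gram sigma = H.
Proof. by move=> defH; apply: form_eqP => u v; rewrite -gramE. Qed.

End InvariantForms.

Theorem theorem1p1 (F : fieldType) (c : involutive_rmorphism F)
    (hc : nontrivial c) (n : nat) (hn : (2 <= n)%N)
    (g : 'M[F]_n) (hg : g \in unitmx) :
  c_real c g <-> has_unitary_rep c g.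
Proof.
case: n => // n in hn g hg *.
have ucg : map_mx c g \in unitmx by rewrite map_unitmx.
have [Q uQ /(simmxP uQ) defQ] := simmx_trmx g.
split=> [[P uP /(simmxP uP) defP] | [sigma [/nondegenerateP uG /isometryP invG]]].
  (* [Q] conjugates [g] to [g^T] and [P] conjugates it to [(g^c)^-1], so [B = Q P^-1] satisfies
     [g^T B g^c = Q g P^-1 g^c = B]. *)
  have [||H [uH adjH invH]] := @invariant_hermitian_ex _ c _ g (Q *m invmx P) hc.
  - by rewrite unitmx_mul uQ unitmx_inv.
  - rewrite !mulmxA -defQ -!mulmxA; congr (_ *m _).
    rewrite -[RHS]mulmx1; apply: (canRL (mulKmx uP)).
    by rewrite !mulmxA defP mulmxK // mulVmx.
  have [sigma defs] := hermitian_form_ex adjH.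
  have defG := gram_form defs.
  by exists sigma; split; [apply/nondegenerateP | apply/isometryP]; rewrite defG.
(* [Q] takes [g] to [g^T], and invariance of the Gram matrix [G] reads
   [G^-1 g^T = (g^c)^-1 G^-1]. *)
exists (invmx (gram sigma) *m Q); first by rewrite unitmx_mul unitmx_inv uG.
apply/simmxP; first by rewrite unitmx_mul unitmx_inv uG.
rewrite -mulmxA defQ !mulmxA; congr (_ *m _).
apply: (canRL (mulmxK uG)).
by rewrite -mulmxA (canRL (mulmxK ucg) invG) mulmxA mulVmx // mul1mx.
Qed.
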